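(* Let $\phi:[0,1]\to[0,\infty)$ be a regular gauge function, let $\mathcal{D}_\phi=\bigcup_j\mathcal{D}_{n_j}$ be a $\phi$-dyadic grid, and let $\mu$ be a finite positive measure on $\partial\mathbb{D}$. If $\mu$ does not charge $\phi$-Beurling-Carleson sets, then for any integer $j_0\ge0$ and any $C>0$, one can write $\mu=\sum_{j=1}^\infty\mu_j$, where the $\mu_j$ are positive measures such that, for each $j$, $\mu_j(I)\le C\phi(|I|)$ for any $I\in\mathcal{D}_{n_{j+j_0}}$.
   Context: Lengths $|\cdot|$ of arcs of the unit circle $\partial\mathbb{D}$ are normalized so that $|\partial\mathbb{D}|=1$. A function $\phi:[0,1]\to[0,\infty)$ is a regular gauge function if: (G1) $\phi(t)=t\,\phi_1(t)=t\int_t^1\frac{ds}{\lambda(s)}$, where $\lambda$ is a non-negative function with $\int_0^1\frac{ds}{\lambda(s)}=\infty$; (G2) $\lambda(\theta t)\asymp\lambda(t)$ for $\theta\in[1,2]$ (doubling, with uniform implicit constants); (G3) there is a constant $C_0>0$ such that $\sum_{k=0}^\infty\phi(2^{-k}t)\le C_0\,\phi(t)$ for $t\in[0,1/2]$. A closed set $E\subset\partial\mathbb{D}$ of zero length is a $\phi$-Beurling-Carleson set if $\sum_k\phi(|J_k|)<\infty$, where $\{J_k\}$ are the complementary arcs of $E$. A measure $\mu$ does not charge $\phi$-Beurling-Carleson sets if $\mu(E)=0$ for every such $E$. For $n\ge0$, $\mathcal{D}_n$ is the collection of the $2^n$ half-open dyadic arcs $\{z\in\partial\mathbb{D}: k2^{-n}2\pi\le\arg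 z<(k+1)2^{-n}2\pi\}$, $k=0,\dots,2^n-1$, so $|I|=2^{-n}$ for $I\in\mathcal{D}_n$. A $\phi$-dyadic grid is a collection $\mathcal{D}_\phi=\bigcup_{j\ge1}\mathcal{D}_{n_j}$, where the increasing sequence of positive integers $\{n_j\}_{j\ge1}$ satisfies $$\int_{2^{-n_{j+1}}}^{2^{-n_j}}\frac{dt}{\lambda(t)}\asymp\int_{2^{-n_j}}^1\frac{dt}{\lambda(t)}=\phi_1(2^{-n_j}),\qquad j=1,2,\dots,$$ with implicit constants independent of $j$. *)

(* Defs.v *)
From HB Require Import structures.
From mathcomp Require Import all_boot all_order all_algebra.
From mathcomp Require Import all_classical all_reals all_analysis.
Set Implicit Arguments.
Unset Strict Implicit.
Unset Printing Implicit Defensive.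
Import Order.TTheory GRing.Theory Num.Theory.
Import numFieldNormedType.Exports.
Local Open Scope classical_set_scope.
Local Open Scope ring_scope.

(* The complex plane, x + iy being the pair (x, y). Its topology and its
   (Borel) sigma-algebra are the product ones. *)
Notation plane R := (measurableTypeR R * measurableTypeR R)%type.

Definition circle (R : realType) : set (plane R) :=
  [set z | z.1 ^+ 2 + z.2 ^+ 2 = 1].
Arguments circle R : clear implicits.

(* exp (2 pi i t) *)
Definition cexp (R : realType) (t : R) : plane R :=
  (cos (2 * pi * t), sin (2 * pi * t)).

(* Normalized arc length: t |-> cexp t is a bijection from [0, 1[ onto the
   circle. *)
Definition arc_length (R : realType) (A : set (plane R)) : \bar R :=
  lebesgue_measure (`[0, 1[ `&` @cexp R @^-1` A).

Definition dyadic_arc (R : realType) (n k : nat) : set (plane R) :=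
  @cexp R @` `[k%:R / 2 ^+ n, k.+1%:R / 2 ^+ n[.
Arguments dyadic_arc R n k : clear implicits.

Definition dyadic_arcs (R : realType) (n : nat) : set (set (plane R)) :=
  [set dyadic_arc R n k | k in [set k | (k < 2 ^ n)%N]].
Arguments dyadic_arcs R n : clear implicits.

(* A measure on the circle is a Borel measure on the plane that is carried by
   the circle. *)
Definition on_circle (R : realType) (mu : set (plane R) -> \bar R) : Prop :=
  mu (~` circle R) = 0%E.

Definition asymp (R : realType) (T : Type) (D : set T) (f g : T -> \bar R) :
    Prop :=
  exists2 C : R, 0 < C &
    forall x, D x -> (C^-1%:E * g x <= f x)%E /\ (f x <= C%:E * g x)%E.

(* The inverse is that of \bar R, so that 1 / 0 = +oo. *)
Definition int_recip (R : realType) (lambda : R -> R) (a b : R) : \bar R :=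
  (\int[lebesgue_measure]_(s in `[a, b]) (lambda s)%:E^-1)%E.

(* phi and lambda are only relevant on [0, 1]. In rgf_G1, the convention
   0 * +oo = 0 of \bar R makes phi 0 = 0, which rgf_G3 also forces.
   Taking lambda Borel rather than Lebesgue measurable loses no generality:
   replacing lambda by the limsup of its averages over [t, t + h] changes it on
   a null set only and preserves rgf_G2. *)
Record regular_gauge (R : realType) (lambda phi : R -> R) : Prop := {
  rgf_ge0 : forall t, 0 <= t <= 1 -> 0 <= phi t ;
  rgf_lambda_ge0 : forall t, 0 <= t <= 1 -> 0 <= lambda t ;
  rgf_lambda_meas : measurable_fun (`[0, 1] : set R) lambda ;
  rgf_lambda_int : int_recip lambda 0 1 = +oo%E ;
  rgf_G1 : forall t, 0 <= t <= 1 ->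
    (phi t)%:E = (t%:E * int_recip lambda t 1)%E ;
  rgf_G2 :
    asymp [set p : R * R | [/\ 1 <= p.1 <= 2, 0 <= p.2 & p.1 * p.2 <= 1]]
      (fun p => (lambda (p.1 * p.2))%:E) (fun p => (lambda p.2)%:E) ;
  rgf_G3 : exists2 C0 : R, 0 < C0 & forall t, 0 <= t <= 2^-1 ->
    (\sum_(0 <= k <oo) (phi (t / 2 ^+ k))%:E <= (C0 * phi t)%:E)%E }.

Definition complementary_arcs (R : realType) (E : set (plane R)) :
    set (set (plane R)) :=
  [set connected_component (circle R `\` E) z | z in circle R `\` E].

Record beurling_carleson (R : realType) (phi : R -> R) (E : set (plane R)) :
    Prop := {
  bc_circle : E `<=` circle R ;
  bc_closed : closed E ;
  bc_length0 : arc_length E = 0%E ;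
  bc_sum : (\esum_(J in complementary_arcs E)
              (phi (fine (arc_length J)))%:E < +oo)%E }.

Definition no_charge (R : realType) (phi : R -> R)
    (mu : set (plane R) -> \bar R) : Prop :=
  forall E, beurling_carleson phi E -> mu E = 0%E.

(* The sequence (n_j) is indexed by j >= 1; n 0 is irrelevant. *)
Record dyadic_grid (R : realType) (lambda : R -> R) (n : nat -> nat) :
    Prop := {
  dg_gt0 : forall j, (1 <= j)%N -> (0 < n j)%N ;
  dg_incr : forall j, (1 <= j)%N -> (n j < n j.+1)%N ;
  dg_asymp : asymp [set j | (1 <= j)%N]
    (fun j => int_recip lambda (2 ^- n j.+1) (2 ^- n j))
    (fun j => int_recip lambda (2 ^- n j) 1) }.

(* Main.v *)
Require Import Defs.
From HB Require Import structures.
From mathcomp Require Import all_boot all_order all_algebra.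
From mathcomp Require Import all_classical all_reals all_analysis.
From mathcomp Require Import measurable_realfun.
From mathcomp Require Import ring lra.
Import Order.TTheory GRing.Theory Num.Theory.
Import numFieldNormedType.Exports.
Local Open Scope classical_set_scope.
Local Open Scope ring_scope.
Set Implicit Arguments.
Unset Strict Implicit.
Unset Printing Implicit Defensive.

(** Write [N_j] for the generation of the [j]-th family of arcs, [j >= 0], and
    [I_j(x)] for the arc of that family that contains [x]. The pieces of [mu] are
    taken greedily: the first one takes from each arc [I] of generation [N_0] as
    much of the mass of [I] as the bound [C phi(|I|)] allows, spread proportionally
    to [mu]; the second one does the same with what is left, and so on. As the
    proportion that is taken is constant on each arc, what is left before stage
    [j] has an explicit density with respect to [mu]: the positive part of
    [1 - load_j], where [load_j(x) = sum_(i < j) C phi(|I_i(x)|) / mu(I_i(x))].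
    So the piece of stage [j] has the density
    [share_j = min(1, load_(j+1)) - min(1, load_j)], and the bound on the arcs holds
    by construction ([share_measure_arc_le]).

    It remains to see that nothing is left in the limit. Up to [mu]-null arcs,
    mass is left over only at the points that lie for every [j] in the union
    [H_j] of the heavy arcs of stage [j], those with [load_(j+1) < 1]. The piece of
    stage [j] gives a heavy arc [I] the mass [C phi(|I|)] exactly, so the sum of
    [phi(|I|)] over all the heavy arcs of all the stages is at most
    [mu(circle) / C]; in terms of [phi(t) = t phi_1(t)] this says that the series of
    the [phi_1(2^-N_j) |H_j|] converges ([heavy_length_le],
    [sum_share_measure_fin]).

    Let [E] be the intersection over [j] of the unions of the closed heavy arcs.
    It is closed, and it has length 0 because [phi_1(2^-N_j) |H_j|] tends to 0
    while [phi_1] is decreasing and positive. A point of the circle outside of [E]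
    has a first stage [j] at which it leaves the heavy arcs. Its arc of generation
    [N_j] then lies, up to [E], in a single complementary arc [J] of [E]
    ([connected_component_arc]), whence [|J| >= 2^-N_j] and
    [phi_1(|J|) <= phi_1(2^-N_j)]. Summing [|J| phi_1(|J|)] over the complementary
    arcs therefore gives at most the sum over [j] of [phi_1(2^-N_j)] times the
    length of the set of points that leave at stage [j], a subset of [H_(j-1)].
    The grid condition bounds [phi_1(2^-N_j)] by a multiple of
    [phi_1(2^-N_(j-1))] ([gauge_factor_growth]), so the sum is finite and [E] is a
    Beurling-Carleson set ([exceptional_beurling_carleson]). By hypothesis
    [mu(E) = 0], so the shares add up to 1 almost everywhere ([sum_share_ae1]). *)

(** * The circle as the image of [0, 1[ *)

Section Circle.
Context {R : realType}.
Implicit Types (x y z : plane R) (s t a b : R) (N M k : nat).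

Lemma cexp_circle t : circle R (cexp t).
Proof. by rewrite /circle /cexp /= cos2Dsin2. Qed.

Lemma cos_eq1 t : 0 <= t < pi *+ 2 -> cos t = 1 -> t = 0.
Proof.
move=> /andP[t0 t2] ct.
have st : sin (t / 2) = 0.
  have : cos (t / 2 *+ 2) = 1 by rewrite -mulr_natr divfK.
  rewrite cos_mulr2n cos2sin2 => h.
  by apply/eqP; rewrite -sqrf_eq0; apply/eqP; lra.
case: (ltrgtP 0 t) t0 => // t0 _.
have : 0 < sin (t / 2).
  by apply: sin_gt0_pi; rewrite divr_gt0//= ltr_pdivrMr// mulr_natr.
by rewrite st ltxx.
Qed.

Lemma cexp_inj s t : `|s - t| < 1 -> cexp s = cexp t -> s = t.
Proof.
wlog : s t / t <= s.
  move=> H; case: (leP t s) => [|/ltW] ts; first exact: H.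
  by rewrite distrC => ? /esym ?; apply/esym/H.
move=> ts; rewrite ger0_norm ?subr_ge0// => st [hc hs].
have pi0 : (0 : R) < pi by exact: pi_gt0.
have : 2 * pi * s - 2 * pi * t = 0.
  apply: cos_eq1; last by rewrite cosB hc hs -!expr2 cos2Dsin2.
  rewrite -mulrBr -[pi *+ 2]mulr_natl; apply/andP; split; last first.
    by rewrite gtr_pMr// mulr_gt0.
  by rewrite mulr_ge0 ?subr_ge0// mulr_ge0// ltW.
rewrite -mulrBr => /eqP; rewrite mulf_eq0 gt_eqF/= ?subr_eq0//; first by move/eqP.
by rewrite mulr_gt0.
Qed.

Lemma cexp_surj z : circle R z -> exists2 t, 0 <= t < 1 & cexp t = z.
Proof.
case: z => a b; rewrite /circle/= => ab.
have pi0 : (0 : R) < pi by exact: pi_gt0.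
have pi2 : (2 * pi : R) != 0 by rewrite gt_eqF// mulr_gt0.
have a1 : -1 <= a <= 1.
  by rewrite -ler_norml -[leRHS](normr1 R) -ler_sqr ?nnegrE// !real_normK ?num_real//; nra.
pose u := acos a.
have cu : cos u = a by rewrite /u acosK.
have su : sin u = `|b|.
  by rewrite /u sin_acos// -sqrtr_sqr; congr Num.sqrt; rewrite -ab; ring.
have u0 : 0 <= u by exact: acos_ge0.
have upi : u <= pi by exact: acos_lepi.
case: (leP 0 b) => b0.
  exists (u / (2 * pi)).
    rewrite divr_ge0//=; last by rewrite mulr_ge0// ltW.
    by rewrite ltr_pdivrMr ?mulr_gt0// mul1r (le_lt_trans upi)// ltr_pMl// ltr1n.
  by rewrite /cexp mulrC divfK// cu su ger0_norm.
exists (1 - u / (2 * pi)).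
  have uN0 : u != 0.
    by apply/eqP => u_0; move: su; rewrite u_0 sin0 ltr0_norm// => h; lra.
  rewrite subr_ge0 ler_pdivrMr ?mulr_gt0// mul1r ltrBlDr ltrDl divr_gt0 ?mulr_gt0//.
    by rewrite andbT (le_trans upi)// ler_pMl// ler1n.
  by rewrite lt_neqAle eq_sym uN0.
rewrite /cexp mulrBr mulr1 [_ * (u / _)]mulrC divfK// -cosN opprB -[sin _]opprK -sinN opprB mulr_natl.
have -> : cos (u - pi *+ 2) = cos u by rewrite -[in RHS](subrK (pi *+ 2) u) cosD2pi.
have -> : sin (u - pi *+ 2) = sin u by rewrite -[in RHS](subrK (pi *+ 2) u) sinD2pi.
by rewrite cu su ltr0_norm// opprK.
Qed.

Lemma continuous_cexp : continuous (@cexp R : R -> plane R).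
Proof.
have c2 t : {for t, continuous (fun t : R => 2 * pi * t)}.
  by apply: continuousM; [exact: cvg_cst|exact: cvg_id].
move=> t; apply: (@cvg_pair _ _ _ (nbhs t) (nbhs (cos (2 * pi * t)))
  (nbhs (sin (2 * pi * t)))).
  exact: (continuous_comp (c2 t) (@continuous_cos R _)).
exact: (continuous_comp (c2 t) (@continuous_sin R _)).
Qed.

Lemma measurable_cexp : measurable_fun [set: measurableTypeR R] (@cexp R).
Proof.
have m2 : measurable_fun setT (fun t : R => 2 * pi * t) by exact: measurable_funM.
apply: measurable_fun_pair.
  exact: (measurableT_comp (continuous_measurable_fun (@continuous_cos R)) m2).
exact: (measurableT_comp (continuous_measurable_fun (@continuous_sin R)) m2).
Qed.

Definition turn x : R := xget 0 [set t | 0 <= t < 1 /\ cexp t = x].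

Lemma turnP x : circle R x -> 0 <= turn x < 1 /\ cexp (turn x) = x.
Proof.
move=> /cexp_surj[t t01 tx]; rewrite /turn; case: xgetP => [u -> //|/(_ t)[]].
by split.
Qed.

Lemma turn_ge0_lt1 x : 0 <= turn x < 1.
Proof. by rewrite /turn; case: xgetP => [u -> [] //|_]; rewrite lexx ltr01. Qed.

Lemma turn_out x : ~ circle R x -> turn x = 0.
Proof.
move=> ncx; rewrite /turn; case: xgetP => // t _ [_ tx].
by case: ncx; rewrite -tx; exact: cexp_circle.
Qed.

Lemma cexpK t : 0 <= t < 1 -> turn (cexp t) = t.
Proof.
move=> t01; have [h hc] := turnP (cexp_circle t).
by apply: cexp_inj => //; rewrite ltr_norml; lra.
Qed.

End Circle.

(** * Borel sets of the plane and dyadic arcs *)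

Section Borel.
Context {R : realType}.

(** The sigma-algebra of the plane is a product of two Borel sigma-algebras. It
    contains an open set because such a set is the union of the countably many
    rational boxes that it contains. *)
Lemma open_measurable_plane (U : set (plane R)) : open U -> measurable U.
Proof.
move=> oU.
pose box (i : rat * rat * nat) : set (plane R) :=
  ball (ratr i.1.1 : R) i.2.+1%:R^-1 `*` ball (ratr i.1.2 : R) i.2.+1%:R^-1.
have -> : U = \bigcup_i (if `[< box i `<=` U >] then box i else set0).
  apply/seteqP; split=> [z Uz|z [i _]]; last by case: asboolP => // + bz; exact.
  have [e /= e0 eU] : exists2 e : R, 0 < e & ball (z : R * R) e `<=` U.
    by have /nbhs_ballP[e /= e0 ?] := open_nbhs_nbhs (conj oU Uz); exists e.
  have [m m2] : exists m : nat, m.+1%:R^-1 < e / 2.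
    have e20 : 0 < e / 2 by rewrite divr_gt0.
    have [m _ /(_ m (leqnn m))] := near_infty_natSinv_lt (PosNum e20).
    by exists m.
  have rt (x : R) : exists q : rat, `|ratr q - x| < m.+1%:R^-1.
    have /rat_in_itvoo[q] : x - m.+1%:R^-1 < x + m.+1%:R^-1.
      by rewrite ltrBlDr -addrA ltrDl addr_gt0.
    by rewrite in_itv/= => h; exists q; rewrite ltr_distl.
  have [p pz] := rt z.1; have [q qz] := rt z.2.
  exists (p, q, m) => //; case: asboolP => [_|[]]; first by split.
  have hb (a b c : R) : `|b - a| < m.+1%:R^-1 -> `|b - c| < m.+1%:R^-1 -> ball a e c.
    move=> ba bc; rewrite /ball/= -(subrK b a) -addrA (le_lt_trans (ler_normD _ _))//.
    by rewrite (splitr e) ltrD// ?(distrC a) (lt_trans _ m2).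
  by move=> w [/= w1 w2]; apply: eU; split; [apply: hb pz _|apply: hb qz _].
apply: countable_bigcupT_measurable => [|i]; first exact: countableP.
by case: ifP => // _; apply: measurableX; exact: measurable_ball.
Qed.

Lemma closed_measurable_plane (U : set (plane R)) : closed U -> measurable U.
Proof. by move/closed_openC/open_measurable_plane/measurableC; rewrite setCK. Qed.

End Borel.

Section DyadicArcs.
Context {R : realType}.
Implicit Types (x y z : plane R) (s t a b : R) (N M k : nat).

Lemma closed_cexp_itv a b : closed (@cexp R @` `[a, b]).
Proof.
apply: compact_closed; first exact: (@norm_hausdorff _ (R^o * R^o)%type).
apply: continuous_compact; last exact: segment_compact.
by apply: continuous_subspaceT => t; exact: continuous_cexp.
Qed.

(** A half-open arc is a countable union of compact ones. *)
Lemma measurable_dyadic_arc N k : measurable (dyadic_arc R N k).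
Proof.
rewrite /dyadic_arc itv_bnd_open_bigcup image_bigcup.
by apply: bigcupT_measurable => i; apply: closed_measurable_plane; exact: closed_cexp_itv.
Qed.

Definition dyadic_index N x : nat := Num.trunc (2 ^+ N * turn x).

Definition arc_of N x : set (plane R) := dyadic_arc R N (dyadic_index N x).

Lemma dyadic_index_lt N x : (dyadic_index N x < 2 ^ N)%N.
Proof.
have /andP[t0 t1] := turn_ge0_lt1 x.
rewrite /dyadic_index truncn_lt_nat; last by rewrite mulr_ge0// exprn_ge0.
by rewrite natrX gtr_pMr// exprn_gt0.
Qed.

(** This equivalence turns membership in a dyadic interval into an equation
    between indices, so that disjointness and nesting of dyadic arcs become
    arithmetic on indices. *)
Lemma dyadic_itv N k t : (k < 2 ^ N)%N ->
  (k%:R / 2 ^+ N <= t < k.+1%:R / 2 ^+ N) =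
  (0 <= t < 1) && (Num.trunc (2 ^+ N * t) == k).
Proof.
move=> kN; have N0 : 0 < 2 ^+ N :> R by exact: exprn_gt0.
have kN' : k.+1%:R <= 2 ^+ N :> R by rewrite -natrX ler_nat.
rewrite ler_pdivrMr// ltr_pdivlMr// (mulrC t).
case: (leP 0 t) => t0 /=; last first.
  by apply/negbTE/negP => /andP[h _]; have := le_trans (ler0n R k) h; rewrite pmulr_rge0// leNgt t0.
rewrite truncn_eq; last by rewrite mulr_ge0// ltW.
case: (ltP t 1) => t1 //=; apply/negbTE/negP => /andP[_ h].
by have := lt_le_trans h kN'; rewrite gtr_pMr// ltNge t1.
Qed.

Lemma dyadic_arcE N k : (k < 2 ^ N)%N ->
  dyadic_arc R N k = circle R `&` [set x | dyadic_index N x = k].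
Proof.
move=> kN; apply/seteqP; split=> [_ [t + <-]|x [cx xk]].
  rewrite /= in_itv/= dyadic_itv// => /andP[t01 /eqP tk]; split; first exact: cexp_circle.
  by rewrite /= /dyadic_index cexpK.
have [t01 tx] := turnP cx; exists (turn x) => //.
by rewrite /= in_itv/= dyadic_itv// t01 -xk eqxx.
Qed.

Lemma arc_ofE N x : arc_of N x = circle R `&` [set y | dyadic_index N y = dyadic_index N x].
Proof. exact/dyadic_arcE/dyadic_index_lt. Qed.

Lemma circle_dyadic_arc : circle R = dyadic_arc R 0 0.
Proof.
rewrite dyadic_arcE//; apply/seteqP; split=> [x cx|x []//]; split => //=.
by have := dyadic_index_lt 0 x; rewrite expn0 ltnS leqn0 => /eqP.
Qed.

Lemma measurable_circle : measurable (circle R).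
Proof. by rewrite circle_dyadic_arc; exact: measurable_dyadic_arc. Qed.

Lemma dyadic_index_coarser N M x : (M <= N)%N ->
  dyadic_index M x = (dyadic_index N x %/ 2 ^ (N - M))%N.
Proof.
move=> MN; have /andP[t0 t1] := turn_ge0_lt1 x.
have d0 : 0 < 2 ^+ (N - M) :> R by exact: exprn_gt0.
rewrite /dyadic_index; set t := turn x in t0 t1 *.
have /truncn_itv : 0 <= 2 ^+ N * t by rewrite mulr_ge0// exprn_ge0.
set k := Num.trunc _ => /andP[kt tk].
have e2 : 2 ^+ N * t = 2 ^+ (N - M) * (2 ^+ M * t) by rewrite mulrA -exprD subnK.
apply: truncn_def; apply/andP; split.
  rewrite -(ler_pM2l d0) -e2 (le_trans _ kt)// -natrX -natrM ler_nat mulnC.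
  exact: leq_divM.
rewrite -(ltr_pM2l d0) -e2 (lt_le_trans tk)// -natrX -natrM ler_nat mulnC.
by rewrite ltn_ceil// expn_gt0.
Qed.

(** Any function of the index is therefore measurable, which covers every density
    and every set built from the dyadic arcs of one generation. *)
Lemma measurable_index N (P : set nat) : measurable [set x | P (dyadic_index N x)].
Proof.
have -> : [set x | P (dyadic_index N x)] =
    (\bigcup_(k in P `&` `I_(2 ^ N)) dyadic_arc R N k) `|`
    (~` circle R `&` [set x | P (dyadic_index N x)]).
  apply/seteqP; split=> [x Px|x].
    have [cx|ncx] := pselect (circle R x); last by right.
    left; exists (dyadic_index N x); first by split => //; exact: dyadic_index_lt.
    by rewrite dyadic_arcE//; exact: dyadic_index_lt.
  by move=> [[k [Pk kN]]|[]//]; rewrite dyadic_arcE// => -[_ /= ->].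
apply: measurableU.
  by apply: bigcup_measurable => k _; exact: measurable_dyadic_arc.
(* off the circle the index is that of the default position 0 *)
have [P0|P0] := pselect (P (Num.trunc (2 ^+ N * (0 : R)))).
  rewrite (_ : _ `&` _ = ~` circle R); first by apply: measurableC; exact: measurable_circle.
  apply/seteqP; split=> [x []//|x ncx]; split => //=.
  by rewrite /dyadic_index turn_out.
rewrite (_ : _ `&` _ = set0)//; apply/seteqP; split=> // x [ncx] /=.
by rewrite /dyadic_index turn_out.
Qed.

Lemma measurable_fun_index d (T : measurableType d) N (F : nat -> T) :
  measurable_fun setT (fun x => F (dyadic_index N x)).
Proof. by move=> _ Y mY; rewrite setTI; exact: (measurable_index N (F @^-1` Y)). Qed.

End DyadicArcs.

(** * Arc length as a measure *)

Section ArcLength.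
Context {R : realType}.
Implicit Types (x y z : plane R) (s t a b : R) (N M k : nat).

Let measurable_cexpI (A : set (plane R)) : measurable A ->
  measurable (`[0, 1[ `&` @cexp R @^-1` A : set R).
Proof.
move=> mA; apply: measurableI; first exact: measurable_itv.
by rewrite -[X in measurable X]setTI; exact: measurable_cexp.
Qed.

Let arc_length0 : arc_length (set0 : set (plane R)) = 0%E.
Proof. by rewrite /arc_length preimage_set0 setI0 measure0. Qed.

Let arc_length_ge0 (A : set (plane R)) : (0 <= arc_length A)%E.
Proof. exact: measure_ge0. Qed.

Let arc_length_sigma_additive : semi_sigma_additive (@arc_length R).
Proof.
move=> F mF tF mUF; rewrite /arc_length preimage_bigcup setI_bigcupr.
apply: measure_semi_sigma_additive.
- by move=> i; exact: measurable_cexpI.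
- by move=> i j _ _ [t [[_ Fi] [_ Fj]]]; apply: (tF i j) => //; exists (cexp t).
- by rewrite -setI_bigcupr -preimage_bigcup; exact: measurable_cexpI.
Qed.

HB.instance Definition _ := isMeasure.Build _ _ _ (@arc_length R)
  arc_length0 arc_length_ge0 arc_length_sigma_additive.

Lemma arc_length_dyadic N k : (k < 2 ^ N)%N ->
  arc_length (dyadic_arc R N k) = (2 ^- N)%:E.
Proof.
move=> kN; have -> : arc_length (dyadic_arc R N k) =
    lebesgue_measure (`[k%:R / 2 ^+ N, k.+1%:R / 2 ^+ N[ : set R).
  congr lebesgue_measure; apply/seteqP; split=> t /=.
    rewrite !in_itv/= => -[t01 [u]]; rewrite /= !in_itv/= => uk ut.
    suff <- : u = t by [].
    apply: cexp_inj => //; move: uk; rewrite dyadic_itv// => /andP[u01 _].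
    by rewrite ltr_norml; lra.
  rewrite in_itv/= => tk; split; last by exists t => //=; rewrite in_itv/=.
  by move: tk; rewrite dyadic_itv// in_itv/= => /andP[].
rewrite lebesgue_measure_itv/= lte_fin ltr_pM2r ?invr_gt0 ?exprn_gt0// ltr_nat leqnn.
by rewrite -EFinB -mulrBl -natrB// subSnn mul1r.
Qed.

Lemma pow2_itv n : 0 < (2 ^- n : R) <= 1.
Proof. by rewrite invr_gt0 exprn_gt0//= invf_le1 ?exprn_gt0// exprn_ege1// ler1n. Qed.

Lemma arc_length_arc_of N x : arc_length (arc_of N x) = (2 ^- N)%:E.
Proof. exact/arc_length_dyadic/dyadic_index_lt. Qed.

Lemma arc_length_circle : arc_length (circle R) = 1%E.
Proof. by rewrite circle_dyadic_arc arc_length_dyadic// expr0 invr1. Qed.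

Lemma closed_set1_plane z : closed [set z].
Proof. exact/accessible_closed_set1/hausdorff_accessible/(@norm_hausdorff _ (R^o * R^o)%type). Qed.

Lemma arc_length_finite (Q : set (plane R)) : finite_set Q -> arc_length Q = 0%E.
Proof.
move=> fQ; have m1 z : measurable [set z].
  by apply: closed_measurable_plane; exact: closed_set1_plane.
have mQ : measurable Q by apply: countable_measurable => //; exact: finite_set_countable.
apply/eqP; rewrite eq_le measure_ge0 andbT.
have := @content_sub_fsum _ _ _ (@arc_length R) _ Q Q (fun z => [set z]) fQ.
move=> /(_ (fun z _ => m1 z) mQ); rewrite fsbig1.
  by apply => z Qz; exists z.
move=> z _; apply/eqP; rewrite eq_le measure_ge0 andbT.
rewrite -(lebesgue_measure_set1 (turn z)) /arc_length.
apply: le_measure; rewrite ?inE//; first exact: measurable_cexpI.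
move=> t /= []; rewrite in_itv/= => t01 tz.
by rewrite -tz cexpK.
Qed.

End ArcLength.

(** * Unions of dyadic arcs and their closed hulls *)

Section Hull.
Context {R : realType}.
Implicit Types (x y z : plane R) (H E : set (plane R)) (N : nat).

(** A union of dyadic arcs of generation [N], given as a set that contains the
    whole arc of each of its points rather than as a list of indices. *)
Definition dyadic_union N H := H `<=` circle R /\ forall x, H x -> arc_of N x `<=` H.

Definition dyadic_hull N H : set (plane R) :=
  \bigcup_(k in dyadic_index N @` H) @cexp R @` `[k%:R / 2 ^+ N, k.+1%:R / 2 ^+ N].

Lemma mem_arc_of N x : circle R x -> arc_of N x x.
Proof. by rewrite arc_ofE. Qed.

Lemma arc_of_sym N x y : circle R x -> arc_of N x y -> arc_of N y x.
Proof. by rewrite !arc_ofE => cx [cy /= ->]. Qed.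

Lemma finite_dyadic_index N H : finite_set (dyadic_index N @` H).
Proof.
apply: (@sub_finite_set _ _ `I_(2 ^ N)); last exact: finite_II.
by move=> _ [x _ <-]; exact: dyadic_index_lt.
Qed.

Lemma dyadic_unionE N H : dyadic_union N H ->
  H = \bigcup_(k in dyadic_index N @` H) dyadic_arc R N k.
Proof.
move=> [Hc HH]; apply/seteqP; split=> [x Hx|x [_ [z Hz <-]]]; last exact: HH.
by exists (dyadic_index N x); [exists x|exact/mem_arc_of/Hc].
Qed.

Lemma measurable_dyadic_union N H : dyadic_union N H -> measurable H.
Proof.
move=> /dyadic_unionE ->.
by apply: bigcup_measurable => k _; exact: measurable_dyadic_arc.
Qed.

Lemma closed_dyadic_hull N H : closed (dyadic_hull N H).
Proof.
apply: closed_bigcup; first exact: finite_dyadic_index.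
by move=> k _; exact: closed_cexp_itv.
Qed.

Lemma dyadic_hull_circle N H : dyadic_hull N H `<=` circle R.
Proof. by move=> _ [k _ [t _ <-]]; exact: cexp_circle. Qed.

Lemma dyadic_union_sub_hull N H : dyadic_union N H -> H `<=` dyadic_hull N H.
Proof.
move=> [Hc _] x Hx; exists (dyadic_index N x); first by exists x.
have [t tx tE] := mem_arc_of N (Hc _ Hx).
by exists t => //; move: tx; rewrite /= !in_itv/= => /andP[kt tk]; rewrite kt ltW.
Qed.

(** Closing the arcs adds finitely many endpoints only. *)
Lemma arc_length_dyadic_hull_le N H : dyadic_union N H ->
  (arc_length (dyadic_hull N H) <= arc_length H)%E.
Proof.
move=> dH; have mH := measurable_dyadic_union dH.
pose Q := (fun k => @cexp R (k.+1%:R / 2 ^+ N)) @` (dyadic_index N @` H).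
have fQ : finite_set Q by exact/finite_image/finite_dyadic_index.
have mQ : measurable Q.
  apply: countable_measurable; last exact: finite_set_countable.
  by move=> z; apply: closed_measurable_plane; exact: closed_set1_plane.
apply: (@le_trans _ _ (arc_length (H `|` Q))).
  apply: le_measure; rewrite ?inE.
  - by apply: closed_measurable_plane; exact: closed_dyadic_hull.
  - exact: measurableU.
  move=> w [k Hk [t]]; rewrite /= in_itv/= => /andP[kt].
  rewrite le_eqVlt => /predU1P[-> <-|tk <-]; first by right; exists k.
  left; case: Hk => z Hz zk; apply: (dH.2 z Hz); rewrite /arc_of zk.
  by exists t => //=; rewrite in_itv/= kt.
apply: le_trans (measureU2 _ mH mQ) _.
by rewrite [X in (_ + X)%E](arc_length_finite fQ) adde0.
Qed.

(** The closed arcs of the hull do not meet the interior of the arc of [x], as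
    this arc is not one of those of [H]. So the subarc from [x] to [y] can meet the
    hull, hence [E], only at the left endpoint of the arc of [x]; this point can
    only be [x] or [y], and neither is in [E]. *)
Lemma connected_component_arc N H E x y :
  dyadic_union N H -> E `<=` dyadic_hull N H -> circle R x -> ~ H x ->
  arc_of N x y -> ~ E x -> ~ E y -> connected_component (circle R `\` E) x y.
Proof.
move=> [Hc HH] EH.
wlog : x y / turn x <= turn y.
  move=> W cx nHx xy nEx nEy.
  case: (leP (turn x) (turn y)) => [|/ltW] txy; first exact: W.
  have yx := arc_of_sym cx xy.
  apply: connected_component_sym; apply: W => //; first by move: xy; rewrite arc_ofE => -[].
  by move=> Hy; apply: nHx; apply: (HH _ Hy).
move=> txy cx nHx; rewrite arc_ofE => -[cy /= yx] nEx nEy.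
have [x01 xE] := turnP cx; have [y01 yE] := turnP cy.
exists (@cexp R @` `[turn x, turn y]); last first.
  by exists (turn y) => //=; rewrite in_itv/= txy/=.
split; first by exists (turn x) => //=; rewrite in_itv/= lexx.
- move=> _ [v + <-]; rewrite /= in_itv/= => /andP[xv vy].
  split; first exact: cexp_circle.
  move: xv; rewrite le_eqVlt => /predU1P[<-|xv]; first by rewrite xE.
  (* A point strictly after [x] is interior to the arc, so it has [0 < v < 1] and
     the position [w <= 1] of an equal point of the hull can only be [v]. *)
  move=> /EH[_ [z Hz <-] [w]]; rewrite /= in_itv/= => /andP[zw wz] wv.
  set k := dyadic_index N z in zw wz *.
  have kN : (k < 2 ^ N)%N by exact: dyadic_index_lt.
  have xN := dyadic_index_lt N x.
  have N0 : 0 < 2 ^+ N :> R by exact: exprn_gt0.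
  have w0 : 0 <= w by apply: le_trans zw; rewrite divr_ge0// ltW.
  have w1 : w <= 1.
    by apply: (le_trans wz); rewrite ler_pdivrMr// mul1r -natrX ler_nat.
  have {}wv : w = v by apply: cexp_inj => //; rewrite ltr_norml; lra.
  subst w; set l := dyadic_index N x in xN *.
  have /andP[kx _] : l%:R / 2 ^+ N <= turn x < l.+1%:R / 2 ^+ N.
    by rewrite dyadic_itv// x01 eqxx.
  have /andP[_ ky] : l%:R / 2 ^+ N <= turn y < l.+1%:R / 2 ^+ N.
    by rewrite dyadic_itv// y01 /l -yx eqxx.
  have h1 : (k < l.+1)%N.
    rewrite -(ltr_nat R) -(@ltr_pM2r _ (2 ^+ N)^-1) ?invr_gt0//.
    by apply: le_lt_trans ky; lra.
  have h2 : (l < k.+1)%N.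
    by rewrite -(ltr_nat R) -(@ltr_pM2r _ (2 ^+ N)^-1) ?invr_gt0//; lra.
  apply: nHx; apply: (HH _ Hz); rewrite arc_ofE; split => //=.
  by apply/eqP; rewrite eqn_leq -ltnS h2 -ltnS h1.
- apply: connected_continuous_connected; first exact: segment_connected.
  by apply: continuous_subspaceT => t; exact: continuous_cexp.
Qed.

End Hull.

(** * A criterion for Beurling-Carleson sets *)

Section Criterion.
Context {R : realType}.
Implicit Types (x y z : plane R) (E : set (plane R)).

(* In the application [phi t = t * g t] and [H j] is the union of the heavy arcs
   of stage [j], whose generation is [N j]. *)
Context (g : R -> R) (K : R) (N : nat -> nat) (H : nat -> set (plane R))
  (g_ge0 : forall t, 0 < t <= 1 -> 0 <= g t)
  (g_anti : forall s t, 0 < s -> s <= t -> t <= 1 -> g t <= g s)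
  (g_growth : forall j, g (2 ^- N j.+1) <= K * g (2 ^- N j))
  (N_mono : {homo N : i j / (i <= j)%N})
  (g_gt0 : 0 < g (2 ^- N 0))
  (dH : forall j, dyadic_union (N j) (H j))
  (sumH : (\sum_(0 <= j <oo) (g (2 ^- N j))%:E * arc_length (H j) < +oo)%E).

Definition exceptional := \bigcap_j dyadic_hull (N j) (H j).

(** The points that leave the sets [H] at stage [j]. *)
Definition shell j := (if j is i.+1 then H i else circle R) `\` H j.

Lemma g_pow2_ge0 n : 0 <= g (2 ^- n).
Proof. exact/g_ge0/pow2_itv. Qed.

Lemma weighted_length_ge0 j (A : set (plane R)) :
  (0 <= (g (2 ^- N j))%:E * arc_length A)%E.
Proof. by apply: mule_ge0; rewrite ?lee_fin ?g_pow2_ge0. Qed.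

Lemma measurable_H j : measurable (H j).
Proof. exact: measurable_dyadic_union (dH j). Qed.

Lemma exceptional_closed : closed exceptional.
Proof. by apply: closed_bigI => j _; exact: closed_dyadic_hull. Qed.

Lemma exceptional_measurable : measurable exceptional.
Proof. by apply: closed_measurable_plane; exact: exceptional_closed. Qed.

Lemma exceptional_hull j : exceptional `<=` dyadic_hull (N j) (H j).
Proof. by move=> x; apply. Qed.

Lemma shell_measurable j : measurable (shell j).
Proof.
apply: measurableD; last exact: measurable_H.
by case: j => [|i]; [exact: measurable_circle|exact: measurable_H].
Qed.

Lemma shell_circle j : shell j `<=` circle R.
Proof. by case: j => [x []//|j x [/(dH j).1]]. Qed.

Lemma shell_cover : circle R `\` exceptional `<=` \bigcup_j shell j.
Proof.
move=> x [cx nEx].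
have [m nHm] : exists m, ~ H m x.
  apply: contrapT => nH; apply: nEx => j _; apply: dyadic_union_sub_hull (dH j) _ _.
  by apply: contrapT => nHj; apply: nH; exists j.
elim: m nHm => [|m IH] nHm; first by exists 0.
have [Hm|/IH//] := pselect (H m x).
by exists m.+1.
Qed.

Let J x := connected_component (circle R `\` exceptional) x.

(** A shell lies outside of [H j], so the arc of generation [N j] of one of its
    points lies, up to the exceptional set, in a single complementary arc. *)
Lemma arc_of_component j x y : J x y -> shell j y ->
  arc_of (N j) y `\` exceptional `<=` J x.
Proof.
move=> xy [_ nHy] z [yz nEz]; apply: (connected_component_trans xy).
have [cy nEy] := connected_component_sub xy.
exact: (connected_component_arc (dH j) (exceptional_hull j)).
Qed.

Lemma component_measurable x : measurable (J x).
Proof.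
suff -> : J x = (\bigcup_j \bigcup_(k in dyadic_index (N j) @` (J x `&` shell j))
    dyadic_arc R (N j) k) `\` exceptional.
  apply: measurableD exceptional_measurable.
  apply: bigcupT_measurable => j; apply: bigcup_measurable => k _.
  exact: measurable_dyadic_arc.
apply/seteqP; split=> [y xy|z [[j _ [_ [y [xy sy] <-]]] yz nEz]].
  have [cy nEy] := connected_component_sub xy; split => //.
  have [j _ sy] := shell_cover (conj cy nEy); exists j => //.
  by exists (dyadic_index (N j) y); [exists y|exact: mem_arc_of].
exact: (arc_of_component xy sy).
Qed.

(** The length of the exceptional set is at most that of each [H j], and the
    weights [g (2 ^- N j)] of the convergent series are bounded away from 0. *)
Lemma exceptional_arc_length : arc_length exceptional = 0%E.
Proof.
apply/eqP; rewrite eq_le measure_ge0 andbT.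
have gE j : ((g (2 ^- N 0))%:E * arc_length exceptional <=
    (g (2 ^- N j))%:E * arc_length (H j))%E.
  apply: lee_pmul; rewrite ?lee_fin ?g_pow2_ge0 ?measure_ge0//.
    have /andP[p0 _] := pow2_itv (R := R) (N j); have /andP[_ p1] := pow2_itv (R := R) (N 0).
    apply: g_anti => //; rewrite lef_pV2 ?posrE ?exprn_gt0// ler_eXn2l ?ltr1n//.
    exact: N_mono.
  apply: le_trans (arc_length_dyadic_hull_le (dH j)).
  apply: le_measure; rewrite ?inE; [exact: exceptional_measurable| |].
    by apply: closed_measurable_plane; exact: closed_dyadic_hull.
  exact: exceptional_hull.
have t0 := nneseries_tail_cvg sumH (fun k _ => weighted_length_ge0 k (H k)).
have g0 : (0 < (g (2 ^- N 0))%:E)%E by rewrite lte_fin.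
rewrite -(pmule_rle0 _ g0).
apply: (cvge_to_ge t0); apply: nearW => m; apply: le_trans (gE m) _.
rewrite (nneseries_split m 1); last first.
  by move=> k _; apply: mule_ge0; rewrite ?lee_fin ?g_pow2_ge0.
rewrite addn1 big_nat1 leeDl// nneseries_ge0// => k _ _.
by apply: mule_ge0; rewrite ?lee_fin ?g_pow2_ge0.
Qed.

Lemma arc_length_component_ge j x y : J x y -> shell j y ->
  ((2 ^- N j)%:E <= arc_length (J x))%E.
Proof.
move=> xy sy; rewrite -(arc_length_arc_of _ y).
have mA : measurable (arc_of (N j) y) by exact: measurable_dyadic_arc.
have mJ := component_measurable x; have mE := exceptional_measurable.
apply: (@le_trans _ _ (arc_length (J x `|` exceptional))).
  apply: le_measure; rewrite ?inE//; first exact: measurableU.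
  move=> z yz; have [Ez|nEz] := pselect (exceptional z); first by right.
  by left; apply: (arc_of_component xy sy).
apply: (@le_trans _ _ (arc_length (J x) + arc_length exceptional)%E).
  exact: measureU2.
by rewrite exceptional_arc_length adde0.
Qed.

Lemma arc_length_component_le1 x : (arc_length (J x) <= 1)%E.
Proof.
rewrite -arc_length_circle; apply: le_measure; rewrite ?inE//.
- exact: component_measurable.
- exact: measurable_circle.
- by move=> y /connected_component_sub[].
Qed.

Lemma arc_length_component_fin x : arc_length (J x) \is a fin_num.
Proof.
by rewrite ge0_fin_numE ?measure_ge0// (le_lt_trans (arc_length_component_le1 x))// ltry.
Qed.

(** The shells that meet a complementary arc cover it, and the weight [g] of the
    arc is at most that of each of them, because the arc is at least as long as
    their dyadic arcs. *)
Lemma arc_length_component_le x :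
  (arc_length (J x) * (g (fine (arc_length (J x))))%:E <=
   \sum_(0 <= j <oo) (g (2 ^- N j))%:E * arc_length (J x `&` shell j))%E.
Proof.
have mJ := component_measurable x.
have J1 := arc_length_component_le1 x; have Jfin := arc_length_component_fin x.
have := @measure_sigma_subadditive _ _ _ (@arc_length R) (J x) (fun j => J x `&` shell j).
move=> /(_ (fun j => measurableI _ _ mJ (shell_measurable j)) mJ) Jsum.
have {}Jsum : (arc_length (J x) <= \sum_(0 <= j <oo) arc_length (J x `&` shell j))%E.
  apply: Jsum; rewrite -setI_bigcupr => y xy; split => //.
  exact/shell_cover/(connected_component_sub xy).
have [J0|J0] := eqVneq (arc_length (J x)) 0%E.
  rewrite J0 mul0e nneseries_ge0// => j _ _.
  by apply: mule_ge0; rewrite ?lee_fin ?g_pow2_ge0.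
have Jpos : 0 < fine (arc_length (J x)).
  by rewrite fine_gt0// lt_neqAle eq_sym J0 measure_ge0 (le_lt_trans J1)// ltry.
have gJ0 : 0 <= g (fine (arc_length (J x))).
  by apply: g_ge0; rewrite Jpos/= -lee_fin fineK.
rewrite muleC.
apply: (@le_trans _ _ ((g (fine (arc_length (J x))))%:E *
   \sum_(0 <= j <oo) arc_length (J x `&` shell j))%E); first exact: lee_wpmul2l.
rewrite -nneseriesZl//; apply: lee_nneseries => [j _ _|j _].
  by apply: mule_ge0; rewrite ?lee_fin.
have [[y [xy sy]]|Js0] := pselect ((J x `&` shell j) !=set0); last first.
  by move/set0P/negP/negPn/eqP : Js0 => ->; rewrite measure0 !mule0.
apply: lee_wpmul2r => //; rewrite lee_fin; have /andP[p0 _] := pow2_itv (R := R) (N j).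
by apply: g_anti => //; rewrite -lee_fin fineK//; exact: arc_length_component_ge xy sy.
Qed.

(** Each shell but the first lies in the previous set [H], whose weight differs by
    a factor [K] at most. *)
Lemma shell_sum : (\sum_(0 <= j <oo) (g (2 ^- N j))%:E * arc_length (shell j) < +oo)%E.
Proof.
have t0 := weighted_length_ge0.
rewrite nneseries_recl// lte_add_pinfty//.
  apply: lte_mul_pinfty; rewrite ?lee_fin ?g_pow2_ge0//.
  apply: (@le_lt_trans _ _ 1%E); last exact: ltry.
  rewrite -arc_length_circle; apply: le_measure; rewrite ?inE; first exact: shell_measurable.
  - exact: measurable_circle.
  - exact: shell_circle.
have K0 : 0 <= K.
  by rewrite -(pmulr_lge0 _ g_gt0); apply: le_trans (g_growth 0); exact: g_pow2_ge0.
apply: (@le_lt_trans _ _ (K%:E *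
    \sum_(0 <= j <oo) (g (2 ^- N j))%:E * arc_length (H j))%E); last first.
  by apply: lte_mul_pinfty; rewrite ?lee_fin.
rewrite -nneseriesZl// -(nneseries_addn 1)//.
apply: lee_nneseries => [j _ _|j _]; first exact: t0.
rewrite muleA addn1; apply: lee_pmul; rewrite ?lee_fin ?g_pow2_ge0//.
by apply: le_measure; rewrite ?inE;
  [exact: shell_measurable|exact: measurable_H|exact: subDsetl].
Qed.

(** The complementary arcs are disjoint, so their parts in a given shell have a
    total length of at most that of the shell. *)
Lemma exceptional_beurling_carleson (phi : R -> R) :
  (forall t, 0 <= t <= 1 -> phi t = t * g t) -> beurling_carleson phi exceptional.
Proof.
move=> phiE; split.
- by move=> x /(_ 0%N I); exact: dyadic_hull_circle.
- exact: exceptional_closed.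
- exact: exceptional_arc_length.
apply: le_lt_trans shell_sum; apply: ub_ereal_sup => _ [X [fX XJ] <-].
have compE A : X A -> exists2 x, (circle R `\` exceptional) x & A = J x.
  by move=> /XJ[x nEx <-]; exists x.
have mX A : X A -> measurable A.
  by move=> /compE[x _ ->]; exact: component_measurable.
apply: (@le_trans _ _ (\sum_(A \in X) \sum_(0 <= j <oo)
    (g (2 ^- N j))%:E * arc_length (A `&` shell j))%E).
  apply: lee_fsum => // A XA; have [x _ ->] := compE _ XA.
  apply: le_trans (arc_length_component_le x).
  have J1 := arc_length_component_le1 x; have Jfin := arc_length_component_fin x.
  rewrite phiE ?fine_ge0 ?measure_ge0//= -?lee_fin ?fineK//.
  by rewrite EFinM fineK.
have t0 := weighted_length_ge0.
rewrite fsbig_finite//= -nneseries_sum//.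
apply: lee_nneseries => [j _ _|j _]; first by apply: sume_ge0.
rewrite -ge0_sume_distrr//.
apply: lee_wpmul2l; first by rewrite lee_fin g_pow2_ge0.
rewrite -(fsbig_finite _ _ fX) -measure_fin_bigcup//; last 2 first.
- move=> A B XA XB [z [[Az _] [Bz _]]].
  have [x _ AE] := compE _ XA; have [y _ BE] := compE _ XB.
  move: Az Bz; rewrite AE BE => xz yz; apply/seteqP; split=> w.
    move=> xw; apply: connected_component_trans yz _.
    by apply: connected_component_trans xw; exact: connected_component_sym.
  move=> yw; apply: connected_component_trans xz _.
  by apply: connected_component_trans yw; exact: connected_component_sym.
- by move=> A XA; apply: measurableI; [exact: mX|exact: shell_measurable].
apply: le_measure; rewrite ?inE; last by move=> x [A _ []].
- apply: fin_bigcup_measurable => // A XA.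
  by apply: measurableI; [exact: mX|exact: shell_measurable].
- exact: shell_measurable.
Qed.

End Criterion.

(** * The gauge *)

Section Gauge.
Context {R : realType} (lambda phi : R -> R) (hphi : regular_gauge lambda phi).

Lemma measurable_invr : measurable_fun [set: R] (fun x : R => x^-1).
Proof.
rewrite -(setUv [set 0]); apply/measurable_funU => //; first exact: measurableC.
split; first exact: measurable_fun_set1.
apply: open_continuous_measurable_fun.
  by apply: closed_openC; exact: closed_eq.
by move=> x; rewrite inE => /eqP x0; exact: inv_continuous.
Qed.

Lemma measurable_fun_recip (D : set R) : measurable D -> measurable_fun D lambda ->
  measurable_fun D (fun s => (lambda s)%:E^-1%E).
Proof.
move=> mD ml; under eq_fun do rewrite inver.
apply: measurable_fun_if => //.
- exact: measurable_fun_eqr.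
- apply/measurable_EFinP; apply: (measurableT_comp measurable_invr).
  by apply: measurable_funS ml => // x [].
Qed.

Lemma measurable_recip (a b : R) : 0 <= a -> b <= 1 ->
  measurable_fun (`[a, b] : set R) (fun s => (lambda s)%:E^-1%E).
Proof.
move=> a0 b1; apply: measurable_fun_recip => //.
apply: measurable_funS (rgf_lambda_meas hphi) => // x.
by rewrite /= !in_itv/= => /andP[ax xb]; rewrite (le_trans a0) ?(le_trans xb).
Qed.

Lemma recip_ge0 (s : R) : 0 <= s <= 1 -> (0 <= (lambda s)%:E^-1)%E.
Proof. by move=> s01; rewrite inve_ge0 lee_fin; exact: (rgf_lambda_ge0 hphi). Qed.

Lemma int_recip_ge0 (a b : R) : 0 <= a -> b <= 1 -> (0 <= int_recip lambda a b)%E.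
Proof.
move=> a0 b1; apply: integral_ge0 => s; rewrite /= in_itv/= => /andP[as_ sb].
by apply: recip_ge0; rewrite (le_trans a0) ?(le_trans sb).
Qed.

Lemma le_int_recip (s t : R) : 0 <= s -> s <= t ->
  (int_recip lambda t 1 <= int_recip lambda s 1)%E.
Proof.
move=> s0 st; apply: ge0_subset_integral => //.
- exact: measurable_recip.
- by move=> u; rewrite /= in_itv/= => /andP[su u1]; apply: recip_ge0; rewrite (le_trans s0).
- by move=> u; rewrite /= !in_itv/= => /andP[tu ->]; rewrite (le_trans st).
Qed.

(** The function [phi_1] with [phi t = t * phi_1 t]. *)
Definition gauge_factor (t : R) : R := fine (int_recip lambda t 1).

Lemma int_recip_fin_num (t : R) : 0 < t <= 1 -> int_recip lambda t 1 \is a fin_num.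
Proof.
move=> /andP[t0 t1]; rewrite ge0_fin_numE ?ltey; last exact: int_recip_ge0 (ltW t0) _.
apply/eqP => Iy; have := rgf_G1 hphi (t := t); rewrite (ltW t0) t1 => /(_ isT).
by rewrite Iy mulry gtr0_sg// mul1e.
Qed.

Lemma gauge_factorE (t : R) : 0 <= t <= 1 -> phi t = t * gauge_factor t.
Proof.
move=> /andP[t0 t1]; have := rgf_G1 hphi (t := t); rewrite t0 t1 => /(_ isT).
move: t0; rewrite le_eqVlt => /predU1P[<-|t0]; first by rewrite mul0e mul0r => -[].
by rewrite -(fineK (int_recip_fin_num _)) ?t0// -EFinM => -[].
Qed.

Lemma gauge_factor_ge0 (t : R) : 0 < t <= 1 -> 0 <= gauge_factor t.
Proof. by move=> /andP[t0 t1]; apply/fine_ge0/int_recip_ge0 => //; exact: ltW. Qed.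

Lemma gauge_factor_anti (s t : R) : 0 < s -> s <= t -> t <= 1 ->
  gauge_factor t <= gauge_factor s.
Proof.
move=> s0 st t1; rewrite fine_le ?int_recip_fin_num//.
- by rewrite (lt_le_trans s0).
- by rewrite s0 (le_trans st).
- by apply: le_int_recip => //; exact: ltW.
Qed.

(** As [lambda] is finite, its reciprocal vanishes nowhere. *)
Lemma gauge_factor_gt0 (t : R) : 0 < t < 1 -> 0 < gauge_factor t.
Proof.
move=> /andP[t0 t1].
have fin := int_recip_fin_num (t := t); rewrite t0 (ltW t1) in fin.
rewrite lt_neqAle gauge_factor_ge0 ?t0 ?ltW// andbT eq_sym.
apply/eqP => I0; have {}I0 : int_recip lambda t 1 = 0%E by rewrite -(fineK (fin isT)) -/(gauge_factor t) I0.
have mf : measurable_fun (`[t, 1] : set R) (fun s => (lambda s)%:E^-1%E).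
  by apply: measurable_recip; rewrite // ltW.
have [+ _] := ae_eq_integral_abs lebesgue_measure (measurable_itv `[t, 1%R]) mf.
have -> : (\int[lebesgue_measure]_(x in `[t, 1%R]) `|(lambda x)%:E^-1| = 0)%E.
  rewrite -[RHS]I0; apply: eq_integral => s; rewrite inE/= in_itv/= => /andP[ts s1].
  by rewrite gee0_abs// recip_ge0// s1 (le_trans _ ts)// ltW.
move=> /(_ erefl)[A [mA A0 tA]].
suff : (lebesgue_measure (`[t, 1%R]%classic : set R) <= lebesgue_measure A)%E.
  rewrite A0 lebesgue_measure_itv/= lte_fin t1 -EFinB lee_fin subr_le0.
  by rewrite leNgt t1.
apply: le_measure; rewrite ?inE// => s ts; apply: tA => /= /(_ ts) /eqP.
by rewrite inve_eq0.
Qed.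

Lemma gauge_factor_growth (n : nat -> nat) : dyadic_grid lambda n ->
  exists K, forall j, (1 <= j)%N ->
    gauge_factor (2 ^- n j.+1) <= K * gauge_factor (2 ^- n j).
Proof.
case=> _ n_incr [C C0 nC]; exists (C + 1) => j j1.
have pow01 m : 0 < (2 ^- m : R) <= 1 by exact: pow2_itv.
have [/andP[a0 a1] /andP[b0 b1]] := (pow01 (n j.+1), pow01 (n j)).
have ab : (2 ^- n j.+1 : R) <= 2 ^- n j.
  by rewrite lef_pV2 ?posrE ?exprn_gt0// ler_eXn2l ?ltr1n// ltnW// n_incr.
rewrite -lee_fin EFinM !fineK ?int_recip_fin_num ?pow01//.
rewrite EFinD ge0_muleDl ?lee_fin ?ler01 ?(ltW C0)// mul1e.
apply: (@le_trans _ _ (int_recip lambda (2 ^- n j.+1) (2 ^- n j) + int_recip lambda (2 ^- n j) 1)%E); last first.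
  by apply: leeD => //; exact: (nC _ j1).2.
rewrite /int_recip -[X in (_ <= _ + X)%E]integral_itv_obnd_cbnd; last first.
  by apply: measurable_funS (measurable_recip (ltW b0) (lexx 1)) => // u; rewrite /= !in_itv/= => /andP[/ltW -> ->].
have U : `[2 ^- n j.+1, 1%R]%classic =
    `[2 ^- n j.+1, 2 ^- n j] `|` `]2 ^- n j, 1%R]%classic :> set R.
  by apply: itv_bndbnd_setU; rewrite bnd_simp.
rewrite U ge0_integral_setU// -?U.
- exact: measurable_recip (ltW a0) (lexx 1).
- move=> u; rewrite /= in_itv/= => /andP[au u1].
  by apply: recip_ge0; rewrite u1 (le_trans (ltW a0)).
- rewrite disj_set2E; apply/eqP/seteqP; split=> // u [].
  by rewrite /= !in_itv/= => /andP[_ ub] /andP[bu _]; move: (le_lt_trans ub bu); rewrite ltxx.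
Qed.

End Gauge.

(** * The greedy decomposition *)

(** The proofs that make this set function a measure are arguments, so that the
    measure structure can be inferred. *)
Definition density {d} {T : measurableType d} {R : realType}
    (mu : {measure set T -> \bar R}) (f : T -> R)
    (mf : measurable_fun setT f) (f_ge0 : forall x, 0 <= f x) (A : set T) : \bar R :=
  (\int[mu]_(x in A) (f x)%:E)%E.

Section DensityMeasure.
Context {d} {T : measurableType d} {R : realType} (mu : {measure set T -> \bar R}).
Context (f : T -> R) (mf : measurable_fun setT f) (f_ge0 : forall x, 0 <= f x).

Let density0 : density mu mf f_ge0 set0 = 0%E.
Proof. exact: integral_set0. Qed.

Let density_ge0 A : (0 <= density mu mf f_ge0 A)%E.
Proof. by apply: integral_ge0 => x _; rewrite lee_fin. Qed.

Let density_sigma_additive : semi_sigma_additive (density mu mf f_ge0).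
Proof.
move=> F mF tF mUF; rewrite /density ge0_integral_bigcup//.
- by apply: is_cvg_nneseries => j _ _; exact: density_ge0.
- by apply: measurable_funTS; exact/measurable_EFinP.
- by move=> x _; rewrite lee_fin.
Qed.

HB.instance Definition _ := isMeasure.Build _ _ _ (density mu mf f_ge0)
  density0 density_ge0 density_sigma_additive.

End DensityMeasure.

Section Greedy.
Context {R : realType} (mu : {finite_measure set (plane R) -> \bar R}).
(* In the application [b j = C * phi (2 ^- N j)] is the mass allowed on an arc. *)
Context (N : nat -> nat) (b : nat -> R)
  (N_mono : {homo N : i j / (i <= j)%N}) (b_ge0 : forall j, 0 <= b j).
Implicit Types x y : plane R.

(** The mass allowed at [x] by the stages before [j], relative to [mu]. An arc of
    measure 0 adds nothing, by the convention [c / 0 = 0]. *)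
Definition load j x : R := \sum_(0 <= i < j) b i / fine (mu (arc_of (N i) x)).

(** The density of the piece of stage [j]. *)
Definition share j x : R := Num.min 1 (load j.+1 x) - Num.min 1 (load j x).

(** Arcs of measure 0 are left out, so that the piece of stage [j] gives every arc
    in this set the mass [b j]. *)
Definition heavy j : set (plane R) :=
  [set x | [/\ circle R x, 0 < fine (mu (arc_of (N j) x)) & load j.+1 x < 1]].

Lemma arc_of_coarser M M' x y : (M <= M')%N -> arc_of M' x y -> arc_of M y = arc_of M x.
Proof.
move=> MM; rewrite arc_ofE => -[_ /= yx].
by rewrite /arc_of !(dyadic_index_coarser _ MM) yx.
Qed.

Lemma load_arc j x y : arc_of (N j) x y -> load j.+1 y = load j.+1 x.
Proof.
move=> xy; apply: eq_big_nat => i /andP[_ ij].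
by rewrite (arc_of_coarser _ xy)//; exact: N_mono.
Qed.

Lemma loadS j x : load j.+1 x = load j x + b j / fine (mu (arc_of (N j) x)).
Proof. by rewrite /load big_nat_recr. Qed.

Lemma load_nondecreasing x : {homo load ^~ x : i j / (i <= j)%N >-> i <= j}.
Proof.
apply: homo_leq => // [i j k|j]; first exact: le_trans.
by rewrite loadS lerDl divr_ge0// fine_ge0.
Qed.

Lemma share_arc j x y : arc_of (N j) x y -> share j y = share j x.
Proof.
move=> xy; rewrite /share (load_arc xy).
suff -> : load j y = load j x by [].
have := load_arc xy; rewrite !loadS.
by rewrite (arc_of_coarser (leqnn _) xy) => /addIr.
Qed.

Lemma share_ge0 j x : 0 <= share j x.
Proof. by rewrite subr_ge0 le_min2// load_nondecreasing. Qed.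

Lemma measurable_load j : measurable_fun setT (load j).
Proof.
apply: measurable_sum => i.
exact: (measurable_fun_index (N i) (fun k => b i / fine (mu (dyadic_arc R (N i) k)))).
Qed.

Lemma measurable_share j : measurable_fun setT (share j).
Proof.
by apply: measurable_funB; apply: measurable_minr => //; exact: measurable_load.
Qed.

Definition share_measure j : {measure set (plane R) -> \bar R} :=
  density mu (measurable_share j) (share_ge0 j).

Lemma share_measure_arc j x :
  share_measure j (arc_of (N j) x) = (share j x * fine (mu (arc_of (N j) x)))%:E.
Proof.
have mA : measurable (arc_of (N j) x) by exact: measurable_dyadic_arc.
rewrite EFinM fineK; last exact: fin_num_measure.
transitivity (\int[mu]_(y in arc_of (N j) x) cst (share j x)%:E y)%E.
  by apply: eq_integral => y; rewrite inE => xy; rewrite (share_arc xy).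
by rewrite integral_cst.
Qed.

(** Truncation at 1 does not enlarge the increase of the load at stage [j], which
    is [b j] divided by the measure of the arc. *)
Lemma share_measure_arc_le j x : (share_measure j (arc_of (N j) x) <= (b j)%:E)%E.
Proof.
rewrite share_measure_arc lee_fin.
have := fine_ge0 (measure_ge0 mu (arc_of (N j) x)).
rewrite le_eqVlt => /predU1P[<-|m0]; first by rewrite mulr0.
rewrite -ler_pdivlMr// /share loadS.
have := divr_ge0 (b_ge0 j) (ltW m0); set c := b j / _ => c0.
by rewrite /Num.min; case: ifPn; case: ifPn; rewrite -?leNgt => *; lra.
Qed.

(** On a heavy arc the truncation is not active yet, so the piece uses up its
    whole allowance. *)
Lemma share_measure_heavy j x : heavy j x ->
  share_measure j (arc_of (N j) x) = (b j)%:E.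
Proof.
move=> [_ m0 l1]; rewrite share_measure_arc /share !min_r ?ltW//.
  by rewrite loadS addrAC subrr add0r divfK ?gt_eqF.
by apply: le_lt_trans l1; exact: load_nondecreasing.
Qed.

Lemma dyadic_union_heavy j : dyadic_union (N j) (heavy j).
Proof.
split=> [x []//|x [cx m0 l1] y xy]; split.
- by move: xy; rewrite arc_ofE => -[].
- by rewrite (arc_of_coarser (leqnn _) xy).
- by rewrite (load_arc xy).
Qed.

Lemma sum_share x n : \sum_(0 <= j < n) share j x = Num.min 1 (load n x).
Proof.
have l0 : load 0 x = 0 by rewrite /load big_geq.
by rewrite (telescope_sumr (fun j => Num.min 1 (load j x)))// l0 (min_r ler01) subr0.
Qed.

Lemma sum_share_le1 x : (\sum_(0 <= j <oo) (share j x)%:E <= 1)%E.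
Proof.
apply: lime_le; first by apply: is_cvg_nneseries => j _ _; rewrite lee_fin share_ge0.
by apply: nearW => n; rewrite sumEFin sum_share lee_fin ge_min lexx.
Qed.

Lemma sum_share1 x j : 1 <= load j x -> (\sum_(0 <= j <oo) (share j x)%:E = 1)%E.
Proof.
move=> l1; apply/eqP; rewrite eq_le sum_share_le1/=.
have s0 k : (0 <= (share k x)%:E)%E by rewrite lee_fin share_ge0.
apply: le_trans (nneseries_lim_ge j (fun k _ _ => s0 k)).
by rewrite sumEFin sum_share min_l.
Qed.

Lemma sum_share_measure (A : set (plane R)) : measurable A ->
  (\sum_(0 <= j <oo) share_measure j A =
   \int[mu]_(x in A) \sum_(0 <= j <oo) (share j x)%:E)%E.
Proof.
move=> mA; rewrite integral_nneseries//.
- by move=> j; apply: measurable_funTS; apply/measurable_EFinP; exact: measurable_share.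
- by move=> j x _; rewrite lee_fin share_ge0.
Qed.

Lemma sum_share_measure_fin : (\sum_(0 <= j <oo) share_measure j setT < +oo)%E.
Proof.
rewrite sum_share_measure//; apply: (@le_lt_trans _ _ (\int[mu]_(x in setT) (cst 1%E x))%E).
  apply: ge0_le_integral => //.
  - by move=> x _; apply: nneseries_ge0 => j _ _; rewrite lee_fin share_ge0.
  - apply: ge0_emeasurable_sum => j *; rewrite ?lee_fin ?share_ge0//.
    apply/measurable_EFinP; exact: measurable_share.
  - by move=> x _; exact: sum_share_le1.
by rewrite integral_cst// mul1e ltey_eq fin_num_measure.
Qed.

(** The heavy arcs of stage [j] are disjoint and each has mass [b j] for the piece
    of stage [j]; [b j * 2 ^+ N j] is that mass per unit of length. *)
Lemma heavy_length_le j :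
  ((b j * 2 ^+ N j)%:E * arc_length (heavy j) <= share_measure j setT)%E.
Proof.
have dH := dyadic_union_heavy j.
set D := dyadic_index (N j) @` heavy j.
have HD : heavy j = \bigcup_(k in D) dyadic_arc R (N j) k by exact: dyadic_unionE.
have fD : finite_set D by exact: finite_dyadic_index.
have mD k : D k -> measurable (dyadic_arc R (N j) k).
  by move=> _; exact: measurable_dyadic_arc.
have tD : trivIset D (dyadic_arc R (N j)).
  move=> k l [x _ <-] [y _ <-] [z []].
  by rewrite -!/(arc_of _ _) !arc_ofE => -[_ /= <-] [_ /= <-].
apply: (@le_trans _ _ (share_measure j (heavy j))); last first.
  by apply: le_measure; rewrite ?inE//; exact: measurable_dyadic_union dH.
rewrite HD measure_fin_bigcup// (measure_fin_bigcup (share_measure j))//.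
rewrite ge0_mule_fsumr//.
apply: lee_fsum => // k [x Hx <-].
suff : ((b j * 2 ^+ N j)%:E * arc_length (arc_of (N j) x) <=
    share_measure j (arc_of (N j) x))%E by [].
rewrite share_measure_heavy// arc_length_arc_of -EFinM lee_fin.
by rewrite mulfK ?gt_eqF ?exprn_gt0.
Qed.

(** Outside of the dyadic arcs of measure 0, a point that is not heavy at some
    stage has load at least 1 there, so that its shares add up to 1. *)
Lemma sum_share_ae1 (E : set (plane R)) : mu (~` circle R) = 0%E ->
  measurable E -> mu E = 0%E -> \bigcap_j heavy j `<=` E ->
  ae_eq mu setT (fun x => \sum_(0 <= j <oo) (share j x)%:E)%E (cst 1%E).
Proof.
move=> muC mE muE HE.
pose null j := \bigcup_(k in [set k | mu (dyadic_arc R (N j) k) = 0%E]) dyadic_arc R (N j) k.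
have mnull j : measurable (null j).
  by apply: bigcup_measurable => k _; exact: measurable_dyadic_arc.
have mC : measurable (~` circle R) by apply: measurableC; exact: measurable_circle.
exists (~` circle R `|` (E `|` \bigcup_j null j)); split.
- by apply: measurableU => //; apply: measurableU => //; exact: bigcupT_measurable.
- apply/negligibleP.
    by apply: measurableU => //; apply: measurableU => //; exact: bigcupT_measurable.
  apply: negligibleU; first exact/negligibleP.
  apply: negligibleU; first exact/negligibleP.
  apply: negligible_bigcup => j.
  rewrite /null bigcup_mkcond; apply: negligible_bigcup => k.
  case: ifPn => [|_]; last exact: negligible_set0.
  by rewrite inE => /= k0; apply/negligibleP => //; exact: measurable_dyadic_arc.
- move=> x /= nx; apply: contrapT => /not_orP[/contrapT cx /not_orP[nEx nnx]].
  apply: nx => _; have [j nHj] : exists j, ~ heavy j x.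
    apply: contrapT => nH; apply/nEx/HE => j _.
    by apply: contrapT => nHj; apply: nH; exists j.
  apply: (@sum_share1 x j.+1); rewrite leNgt; apply/negP => l1.
  apply: nHj; split => //; rewrite lt_neqAle fine_ge0// andbT.
  apply/eqP => m0; apply: nnx; exists j => //.
  exists (dyadic_index (N j) x); last exact: mem_arc_of.
  rewrite /= -(fineK (fin_num_measure mu _ _)) -?m0//.
  exact: measurable_dyadic_arc.
Qed.

End Greedy.

(** * The decomposition *)

Lemma dyadic_grid_homo {R : realType} (lambda : R -> R) (n : nat -> nat) (j0 : nat) :
  dyadic_grid lambda n -> {homo (fun j => n (j + j0.+1)%N) : i j / (i <= j)%N}.
Proof.
move=> hn; apply: homo_leq => // [i j k|j]; first exact: leq_trans.
by rewrite addSn ltnW//; apply: (dg_incr hn); rewrite addnS.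
Qed.

Theorem corollary3p3 (R : realType) (lambda phi : R -> R) (n : nat -> nat)
    (mu : {finite_measure set (plane R) -> \bar R})
    (hphi : regular_gauge lambda phi)
    (hn : dyadic_grid lambda n)
    (hmu : on_circle mu)
    (hcharge : no_charge phi mu)
    (j0 : nat) (C : R) (hC : 0 < C) :
  exists mu_ : nat -> {measure set (plane R) -> \bar R},
    [/\ forall j, (1 <= j)%N -> on_circle (mu_ j),
        forall A : set (plane R), measurable A ->
          mu A = (\sum_(1 <= j <oo) mu_ j A)%E
      & forall j, (1 <= j)%N -> forall I, dyadic_arcs R (n (j + j0)%N) I ->
          (mu_ j I <= (C * phi (fine (arc_length I)))%:E)%E].
Proof.
pose N j := n (j + j0.+1)%N.
have N_mono : {homo N : i j / (i <= j)%N} by exact: dyadic_grid_homo hn.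
have [K gK] := gauge_factor_growth hphi hn.
pose g := gauge_factor lambda.
pose b j := C * phi (2 ^- N j).
have bE j : b j * 2 ^+ N j = C * g (2 ^- N j).
  have /andP[p0 p1] := pow2_itv (R := R) (N j).
  rewrite /b (gauge_factorE hphi); last by rewrite ltW.
  by rewrite -!mulrA; congr (C * _); rewrite mulrCA mulVf ?mulr1// gt_eqF// exprn_gt0.
have b_ge0 j : 0 <= b j.
  have /andP[p0 p1] := pow2_itv (R := R) (N j).
  by rewrite mulr_ge0 ?(ltW hC)// (rgf_ge0 hphi)// ltW.
have g_ge0 := gauge_factor_ge0 hphi.
have H_dyadic := @dyadic_union_heavy _ mu _ b N_mono.
pose nu := share_measure mu N b_ge0.
have sumH : (\sum_(0 <= j <oo) (g (2 ^- N j))%:E * arc_length (heavy mu N b j) < +oo)%E.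
  apply: (@le_lt_trans _ _ (C^-1%:E * \sum_(0 <= j <oo) nu j setT)%E); last first.
    by apply: lte_mul_pinfty; rewrite ?lee_fin ?invr_ge0 ?(ltW hC)//; exact: sum_share_measure_fin.
  rewrite -nneseriesZl; last by move=> j _; exact: measure_ge0.
  apply: lee_nneseries => [j _ _|j _].
    by apply: mule_ge0; rewrite ?lee_fin ?g_ge0 ?pow2_itv.
  apply: (@le_trans _ _ (C^-1%:E * ((b j * 2 ^+ N j)%:E * arc_length (heavy mu N b j)))%E).
    by rewrite bE muleA -EFinM mulKf ?gt_eqF.
  by apply: lee_wpmul2l; [rewrite lee_fin invr_ge0 ltW|exact: heavy_length_le].
pose E := exceptional N (heavy mu N b).
have BE : beurling_carleson phi E.
  apply: (exceptional_beurling_carleson (K := K) (g := g)) => //.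
  - exact: gauge_factor_anti hphi.
  - by move=> j; exact: (gK (j + j0.+1)%N (ltn_addl j (ltn0Sn j0))).
  - apply: (gauge_factor_gt0 hphi); rewrite invr_gt0 exprn_gt0//= invf_lt1 ?exprn_gt0//.
    by rewrite exprn_egt1 ?ltr1n// -lt0n; exact: (dg_gt0 hn).
  - exact: gauge_factorE hphi.
have mE : measurable E by apply: closed_measurable_plane; exact: bc_closed BE.
have HE : \bigcap_j heavy mu N b j `<=` E.
  by move=> x Hx j _; apply: dyadic_union_sub_hull (H_dyadic j) _ (Hx j I).
have ae1 := sum_share_ae1 b_ge0 hmu mE (hcharge _ BE) HE.
(* The stages are counted from 0 and the pieces from 1. *)
exists (fun j => nu j.-1); split.
- move=> j _; apply: null_set_integral => //.
  + by apply: measurableC; exact: measurable_circle.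
  + by apply: measurable_funTS; apply/measurable_EFinP; exact: measurable_share.
- move=> A mA; rewrite -(nneseries_addn 1) => [|j]; last exact: measure_ge0.
  under eq_eseriesr do rewrite addn1.
  rewrite sum_share_measure// -[LHS]mul1e -integral_cst//.
  apply: ge0_ae_eq_integral => //.
  + apply: ge0_emeasurable_sum => j *; rewrite ?lee_fin ?share_ge0//.
    by apply: measurable_funTS; apply/measurable_EFinP; exact: measurable_share.
  + by move=> x _; apply: nneseries_ge0 => j _ _; rewrite lee_fin share_ge0.
  + by apply: filterS ae1 => x /(_ I) /= ->.
- move=> [//|j] _ _ [k /= kn <-].
  have {}kn : (k < 2 ^ N j)%N by rewrite /N addnS -addSn.
  rewrite arc_length_dyadic; last by rewrite addSn -addnS.
  pose x : plane R := cexp (k%:R / 2 ^+ N j).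
  have kx : dyadic_arc R (N j) k x.
    exists (k%:R / 2 ^+ N j) => //=; rewrite in_itv/= lexx/=.
    by rewrite ltr_pM2r ?invr_gt0 ?exprn_gt0// ltr_nat.
  have -> : dyadic_arc R (n (j.+1 + j0)%N) k = arc_of (N j) x.
    rewrite /arc_of (_ : dyadic_index _ x = k); first by rewrite /N addnS addSn.
    by move: kx; rewrite dyadic_arcE// => -[].
  apply: le_trans (share_measure_arc_le mu N_mono b_ge0 j x) _.
  by rewrite lee_fin /b /N addnS addSn.
Qed.
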